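(* Let $(b_n)_{n\in\mathbb{N}}$ be a sequence of pairwise coprime positive integers such that $\sum_{n\in\mathbb{N}} 8\pi^2/b_n^2<1$. Then $A=\mathrm{SL}_2(\mathbb{Z})\setminus\bigcup_{n\in\mathbb{N}}\Gamma(b_n)$ has positive lower density, i.e. $\underline{d}(A)>0$.
   Context: For $n\in\mathbb{N}$, $\Gamma(n)$ denotes the subgroup of all matrices in $\mathrm{SL}_2(\mathbb{Z})$ that are congruent entrywise to the identity matrix modulo $n$. Let $F_n$ be the (finite) set of matrices $\begin{pmatrix}a&b\\c&d\end{pmatrix}\in\mathrm{SL}_2(\mathbb{Z})$ with $|a|,|b|,|c|,|d|\le n$. The lower density of $A\subseteq\mathrm{SL}_2(\mathbb{Z})$ is $\underline{d}(A)=\liminf_{n\to\infty}|A\cap F_n|/|F_n|$. *)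

(* Defs.v *)
From HB Require Import structures.
From mathcomp Require Import all_boot all_order all_algebra finmap.
From mathcomp Require Import all_classical all_reals all_analysis.

Set Implicit Arguments.
Unset Strict Implicit.
Unset Printing Implicit Defensive.

Import Order.TTheory GRing.Theory Num.Theory.

Local Open Scope classical_set_scope.
Local Open Scope ring_scope.

Definition SL2Z : set 'M[int]_2 := [set M | \det M = 1].

Definition Gamma (n : nat) : set 'M[int]_2 :=
  [set M | SL2Z M /\
    forall i j, (M i j = (1%:M : 'M[int]_2) i j %[mod n%:Z])%Z].

Definition SL2Z_box (n : nat) : set 'M[int]_2 :=
  [set M | SL2Z M /\ forall i j, `|M i j| <= n%:Z].

(* [fset_set] returns the empty set on infinite sets, so the cardinals in
   [lower_density] rely on this lemma. *)
Lemma finite_SL2Z_box (n : nat) : finite_set (SL2Z_box n).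
Proof.
pose f (N : 'M['I_(n + n).+1]_2) : 'M[int]_2 :=
  \matrix_(i, j) ((N i j : nat)%:Z - n%:Z).
apply: (@sub_finite_set _ _ (f @` setT)); last first.
  by apply: finite_image; exact: finite_finset.
move=> M [_ leM]; exists (\matrix_(i, j) inord `|(M i j + n%:Z)%R|%N) => //.
apply/matrixP => i j; rewrite !mxE.
have := leM i j; rewrite ler_norml => /andP[lo hi].
have ge0 : 0 <= M i j + n%:Z by rewrite -lerBlDr sub0r.
rewrite inordK; first by rewrite gez0_abs // addrK.
by rewrite ltnS -lez_nat gez0_abs // PoszD lerD2r.
Qed.

(* The term at n = 0 is 0 / 0 = 0, which does not affect the limit inferior. *)
Definition lower_density (R : realType) (A : set 'M[int]_2) : \bar R :=
  limn_einf (fun n : nat =>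
    ((#|` fset_set (A `&` SL2Z_box n)|%fset)%:R
      / (#|` fset_set (SL2Z_box n)|%fset)%:R : R)%:E).

(* Main.v *)
Require Import Defs.
From HB Require Import structures.
From mathcomp Require Import all_boot all_order all_algebra finmap.
From mathcomp Require Import all_classical all_reals all_analysis.
From mathcomp Require Import zify ring lra.

Import Order.TTheory GRing.Theory Num.Theory.
Import numFieldNormedType.Exports.

Local Open Scope classical_set_scope.
Local Open Scope ring_scope.

(** Write F_n for the box [SL2Z_box n].  The proof is a union bound whose terms
    are uniform in the level: for every b > 2 and every n, _including_ n smaller
    than b,
<<
      #((Gamma(b) cap F_n) minus the identity) <= 18 n^2 / b^2,   n^2 / 4 <= #F_n.
>>
    Since pi >= 3, one has 18 * 4 = 72 <= 8 pi^2, so the proportion of F_n covered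
    by the Gamma(b_k) is at most S + 1 / #F_n, where S < 1 is the sum of the
    8 pi^2 / b_k^2; the last term accounts for the identity, which lies in every
    Gamma(b_k) and has to be counted once and for all.  The lower density is thus
    at least (1 - S) / 2.  The hypothesis S < 1 also forces b_k > 2.

    Upper bound ([card_Gamma_box]).  If n < b, the congruences leave only the
    identity.  Otherwise classify the matrices of Gamma(b) by the column that
    contains an entry of largest absolute value m.  Two matrices of determinant 1
    that share this column differ in the other one by a multiple t of it; in
    Gamma(b) the level b divides t, while the size constraint gives t m <= 2 m in
    absolute value, so t = 0 because b > 2 ([completion_unique]).  It remains to
    count the dominant columns: each of the two entries lies in a fixed residue
    class mod b inside [-n, n], hence takes at most 2n/b + 1 <= 3n/b values, and
    the two choices of column give 2 * 9 = 18.

    Lower bound ([card_SL2Z_box_ge]).  A coprime pair in [1, n]^2 is the first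
    column of a matrix in F_n by Bezout, and a pair that is not coprime has a
    common divisor d >= 2, so that the number of these pairs is at most
    sum_(d >= 2) (n / d)^2 <= (3 / 4) n^2. *)

Local Notation card A := (#|` fset_set A|)%fset.

(** * The bound pi >= 3 *)

Lemma le_sin (R : realType) (x : R) : 0 <= x -> sin x <= x.
Proof.
move=> x0.
have ct : {within `[0, x], continuous (@sin R)}.
  by apply: continuous_subspaceT; exact: continuous_sin.
have [c _] := MVT_segment x0 (fun y _ => is_derive_sin y) ct.
rewrite sin0 !subr0 => ->.
by rewrite -[leRHS]mul1r ler_wpM2r ?cos_le1.
Qed.

(** Tripling the angle turns sin (pi / 2) = 1 into the cubic equation
    (s + 1) (s - 1/2)^2 = 0 for s = sin (pi / 6). *)
Lemma sin_pi6 (R : realType) : sin (pi / 6) = 1 / 2 :> R.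
Proof.
set x : R := pi / 6.
have x2 : sin (x *+ 2 + x) = 1.
  by rewrite (_ : x *+ 2 + x = pi / 2) ?sin_pihalf // /x; field.
have s0 : 0 < sin x.
  by apply: sin_gt0_pi; rewrite /x; have := @pi_gt0 R => ?; apply/andP; split; lra.
move: x2; rewrite sinD sin_mulr2n cos_mulr2n.
have := sin2cos2 x; move: s0; set s := sin x; set c := cos x => s0 cs.
have {}cs : c ^+ 2 = 1 - s ^+ 2 by rewrite cs; ring.
rewrite (_ : _ + _ = (c ^+ 2 *+ 4 - 1) * s); last by ring.
rewrite cs => e.
have /eqP : (s + 1) * (s - 1 / 2) ^+ 2 = 0.
  transitivity ((1 - ((1 - s ^+ 2) *+ 4 - 1) * s) / 4); first by field.
  by rewrite e subrr mul0r.
rewrite mulf_eq0 expf_eq0 /= => /orP[]/eqP; lra.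
Qed.

(** This is sin x <= x at x = pi / 6. *)
Lemma pi_ge3 (R : realType) : 3 <= pi :> R.
Proof.
have := @le_sin R (pi / 6); rewrite sin_pi6.
have := @pi_gt0 R => p0 /(_ _); have h : 0 <= (pi : R) / 6 by lra.
by move=> /(_ h); lra.
Qed.

Lemma pi_sqr_ge9 (R : realType) : 9 <= pi ^+ 2 :> R.
Proof.
by rewrite (_ : 9 = 3 ^+ 2) ?ler_pXn2r ?nnegrE ?pi_ge0 ?pi_ge3 //; ring.
Qed.

(** * Counting coprime pairs *)

(** The term 1/d^2 is compared with 1/(d - 1) - 1/d, which telescopes, from d = 3
    on; keeping 1/4 exact for d = 2 is what brings the total below 1. *)
Lemma sum_invsqr_le (F : realFieldType) (n : nat) :
  \sum_(2 <= d < n.+3) (d%:R ^- 2 : F) <= 3 / 4 - n.+2%:R^-1.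
Proof.
elim: n => [|n IHn]; first by rewrite big_nat1; lra.
rewrite big_nat_recr //; apply: le_trans (lerD IHn (lexx _)) _.
have : 0 < n.+2%:R :> F by rewrite ltr0n.
rewrite -[n.+3]addn1 natrD; move: (n.+2%:R : F) => x x0.
have : 0 < x^-1 - (x + 1)^-1 - (x + 1) ^- 2.
  have -> : x^-1 - (x + 1)^-1 - (x + 1) ^- 2 = (x * (x + 1) ^+ 2)^-1.
    by field; apply/andP; split; lra.
  by rewrite invr_gt0 mulr_gt0 // exprn_gt0 //; lra.
lra.
Qed.

Lemma sum_sqr_divn_le (n : nat) :
  (4 * \sum_(2 <= d < n.+1) (n %/ d) ^ 2 <= 3 * n ^ 2)%N.
Proof.
case: n => [|[|n]]; [by rewrite big_geq|by rewrite big_geq|].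
rewrite -(ler_nat rat) natrM [leRHS]natrM natrX natr_sum.
have n0 : (0 : rat) < n.+2%:R by rewrite ltr0n.
apply: (@le_trans _ _ (4 * \sum_(2 <= d < n.+3) (n.+2%:R ^+ 2 * d%:R ^- 2))).
  rewrite ler_pM2l // !big_nat; apply: ler_sum => d /andP[d2 _].
  have d0 : (0 : rat) < d%:R by rewrite ltr0n (leq_trans _ d2).
  rewrite natrX -exprVn -exprMn ler_pXn2r ?nnegrE ?mulr_ge0 ?invr_ge0 ?ler0n //.
  by rewrite ler_pdivlMr // -natrM ler_nat leq_divM.
rewrite -mulr_sumr; set S := \sum_(_ <= _ < _) _.
have S34 : S <= 3 / 4.
  by apply: le_trans (sum_invsqr_le _ n) _; rewrite gerBl invr_ge0 ler0n.
have : n.+2%:R ^+ 2 * S <= n.+2%:R ^+ 2 * (3 / 4) by rewrite ler_wpM2l ?exprn_ge0.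
lra.
Qed.

(** Every pair is coprime or counted by some d >= 2 dividing both entries. *)
Lemma coprime_pairs_ge (n : nat) :
  (n ^ 2 <= 4 * #|[pred p : 'I_n * 'I_n | coprime p.1.+1 p.2.+1]|)%N.
Proof.
set C := #|_|.
have le1 : (n ^ 2 <= C + \sum_(2 <= d < n.+1) (n %/ d) ^ 2)%N.
  have -> : (n ^ 2 = \sum_(p : 'I_n * 'I_n) 1)%N.
    by rewrite sum1_card card_prod card_ord mulnn.
  have -> : C = (\sum_(p : 'I_n * 'I_n) coprime p.1.+1 p.2.+1)%N.
    by rewrite /C -sum1_card big_mkcond.
  have div d : ((n %/ d) ^ 2 =
      \sum_(p : 'I_n * 'I_n) ((d %| p.1.+1) && (d %| p.2.+1)))%N.
    rewrite divn_count_dvd big_add1 /= big_mkord -mulnn big_distrlr /=.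
    by rewrite pair_bigA; apply: eq_bigr => p _; rewrite mulnb.
  under [X in (_ <= _ + X)%N]eq_bigr do rewrite div.
  rewrite exchange_big -big_split /=; apply: leq_sum => p _.
  have [//|ncop] := boolP (coprime _ _).
  (* The gcd itself is one of the divisors d counted on the right. *)
  set g := gcdn p.1.+1 p.2.+1.
  have g0 : (0 < g)%N by rewrite gcdn_gt0.
  have gn : (g < n.+1)%N.
    by rewrite ltnS (leq_trans (dvdn_leq _ (dvdn_gcdl _ _))) // ltn_ord.
  have g2 : (2 <= g)%N by move: ncop; rewrite /coprime -/g; lia.
  rewrite (big_cat_nat g2 (ltnW gn)) /= [X in (_ <= _ + (_ + X))%N]big_ltn //.
  by rewrite dvdn_gcdl dvdn_gcdr; lia.
have := sum_sqr_divn_le n; lia.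
Qed.

(** Reducing the Bezout coefficient modulo i makes the second column no larger than
    the first one, so that it stays in every box that contains the first. *)
Lemma bezout_completion (i j : nat) : (0 < i)%N -> (0 < j)%N -> coprime i j ->
  exists2 p : nat * nat, (p.1 <= i)%N && (p.2 <= j)%N & (i * p.2 = 1 + p.1 * j)%N.
Proof.
move=> i0 j0 cij; have [y yi /dvdnP[d]] := Bezoutl j i0.
rewrite (eqP cij) => e; exists (y, d) => /=; last by rewrite e mulnC.
rewrite (ltnW yi) /= -(leq_pmul2r i0) -e.
have : (y.+1 * j <= i * j)%N by rewrite leq_mul2r yi orbT.
by rewrite mulSn; lia.
Qed.

(** * Cardinals of finite sets *)

Lemma card_leq_fintype {T : choiceType} {U : finType} (A : set T) (f : T -> U) :
  finite_set A -> (forall x y, A x -> A y -> f x = f y -> x = y) ->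
  (card A <= #|U|)%N.
Proof.
move=> finA injf.
have memA x : x \in fset_set A -> A x by rewrite in_fset_set // inE.
rewrite -(size_map f) -(card_uniqP _) ?max_card // map_inj_in_uniq ?fset_uniq //.
by move=> x y /memA Ax /memA Ay; exact: injf.
Qed.

Lemma fintype_leq_card {T : choiceType} {U : finType} (P : {pred U}) (A : set T)
    (f : U -> T) :
  finite_set A -> {in P, forall u, A (f u)} -> {in P &, injective f} ->
  (#|P| <= card A)%N.
Proof.
move=> finA PA injf; rewrite cardE -(size_map f); apply: uniq_leq_size.
  by rewrite map_inj_in_uniq ?enum_uniq // => u v; rewrite !mem_enum; exact: injf.
move=> x /mapP[u]; rewrite mem_enum => Pu ->.
by have := in_fset_set finA (f u) => ->; rewrite inE; exact: PA.
Qed.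

Lemma card_setU_leq {T : choiceType} (A B : set T) :
  finite_set A -> finite_set B -> (card (A `|` B) <= card A + card B)%N.
Proof. by move=> fA fB; rewrite fset_setU // cardfsU leq_subr. Qed.

Lemma card_sub_leq {T : choiceType} (A B : set T) :
  finite_set B -> A `<=` B -> (card A <= card B)%N.
Proof.
move=> fB AB; have fA := sub_finite_set AB fB.
by apply: fsubset_leq_card; rewrite -fset_set_sub.
Qed.

(** A finite set is already covered by finitely many terms of a countable cover,
    which reduces the union bound to finite sums. *)
Lemma card_bigcup_leq {T : choiceType} (G : nat -> set T) (X : set T) :
  finite_set X -> X `<=` \bigcup_k G k ->
  exists K, (card X <= \sum_(k < K) card (X `&` G k))%N.
Proof.
move=> fX XG.
have [K XK] : exists K, X `<=` \bigcup_(k < K) G k.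
  have ex x : exists k, x \in fset_set X -> G k x.
    have [|xX] := boolP (x \in fset_set X); last by exists 0%N.
    by rewrite in_fset_set // inE => /XG[k _ Gk]; exists k.
  have [h hP] := choice ex; exists (\max_(x <- fset_set X) h x).+1.
  move=> x Xx; have xX : x \in fset_set X by rewrite in_fset_set // inE.
  by exists (h x); [rewrite /= ltnS; apply: leq_bigmax_seq|exact: hP].
exists K; elim: K {XG} X fX XK => [|K IH] X fX XK.
  have -> : X = set0 by apply/seteqP; split => // x /XK[].
  by rewrite fset_set0 cardfs0.
have fD : finite_set (X `\` G K) by exact: finite_setD.
rewrite big_ord_recr /=; apply: (@leq_trans (card (X `\` G K) + card (X `&` G K))).
  by rewrite -{1}(setUIDK X (G K)) setUC card_setU_leq //; apply: finite_setI; left.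
rewrite leq_add2r.
have /leq_trans -> // :
    (card (X `\` G K) <= \sum_(k < K) card ((X `\` G K) `&` G k))%N.
  apply: IH => // x [/XK[k /= kK Gk] nGK]; exists k => //=.
  by move: kK; rewrite ltnS leq_eqVlt => /orP[/eqP kK|//]; rewrite kK in Gk.
apply: leq_sum => k _; apply: card_sub_leq; first by apply: finite_setI; left.
by move=> x [[]].
Qed.

(** * Columns of matrices in a congruence subgroup *)

(** Two completions (y, d) and (y', d') of the column (a, c) differ by t (a, c) with
    t = y d' - y' d, and b divides t because it divides y and y'.  If the entries
    of the completions do not exceed m = max(|a|, |c|), then |t| m <= 2 m. *)
Lemma completion_unique (b : nat) (a c y d y' d' m : int) :
  (2 < b)%N -> a * d - y * c = 1 -> a * d' - y' * c = 1 ->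
  (b%:Z %| y)%Z -> (b%:Z %| y')%Z ->
  m = `|a| \/ m = `|c| ->
  `|y| <= m -> `|d| <= m -> `|y'| <= m -> `|d'| <= m ->
  y = y' /\ d = d'.
Proof.
move=> b2 e e' by_ by' mE ym dm y'm d'm.
set t := y * d' - y' * d.
have ey : y - y' = a * t.
  transitivity (y * (a * d' - y' * c) - y' * (a * d - y * c)).
    by rewrite e e'; ring.
  by rewrite /t; ring.
have ed : d - d' = c * t.
  transitivity (d * (a * d' - y' * c) - d' * (a * d - y * c)).
    by rewrite e e'; ring.
  by rewrite /t; ring.
have bt : (b%:Z %| t)%Z by rewrite /t rpredB // dvdz_mulr.
have m0 : m != 0.
  apply/eqP => m0; move: ym dm y'm d'm e; rewrite m0.
  by rewrite !normr_le0 => /eqP-> /eqP-> _ _; lia.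
have m1 : 0 < m by rewrite lt_neqAle eq_sym m0 (le_trans _ ym).
have t2 : `|t| <= 2.
  rewrite -(ler_pM2l m1); case: mE => {1}->; rewrite -normrM -?ey -?ed;
  by apply: le_trans (ler_normB _ _) _; rewrite mulr_natr mulr2n lerD.
have t0 : t = 0.
  apply/eqP; move: bt; rewrite dvdzE; have [//|tn0] := eqVneq t 0.
  move/dvdn_leq; move: t2 tn0 b2; clear; lia.
by move: ey ed; rewrite t0 !mulr0 => /subr0_eq -> /subr0_eq ->.
Qed.

(** Position of [x] among the elements of its residue class mod [b] in the
    interval [-n, n]. *)
Definition residue_index (n b : nat) (x : int) : 'I_((2 * n) %/ b).+1 :=
  inord (`|(x + n%:Z)%R|%N %/ b).

Lemma residue_index_inj (n b : nat) (x x' : int) : (0 < b)%N ->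
  `|x| <= n%:Z -> `|x'| <= n%:Z -> (b%:Z %| x - x')%Z ->
  residue_index n b x = residue_index n b x' -> x = x'.
Proof.
move=> b0 xn x'n bd /(congr1 val); rewrite /= !inordK; last 2 first.
- by rewrite ltnS leq_div2r //; lia.
- by rewrite ltnS leq_div2r //; lia.
move=> /(congr1 Posz); rewrite -!divz_nat !gez0_abs; [|lia|lia].
have /dvdzP[q qE] := bd.
have -> : x + n%:Z = q * b%:Z + (x' + n%:Z) by rewrite -qE; ring.
rewrite divzMDl; last by lia.
move=> e; have q0 : q = 0 by apply: (addIr ((x' + n%:Z) %/ b)%Z); rewrite add0r.
by apply: subr0_eq; rewrite qE q0 mul0r.
Qed.

(** * A lower bound for the number of matrices in a box *)

Lemma ord2_cases (i : 'I_2) : i = 0 \/ i = 1.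
Proof. by case: i => [[|[|//]] ?]; [left|right]; exact: val_inj. Qed.

Lemma det_mx22 (F : comPzRingType) (M : 'M[F]_2) :
  \det M = M 0 0 * M 1 1 - M 0 1 * M 1 0.
Proof.
rewrite (expand_det_row _ 0) !big_ord_recl big_ord0 addr0 /cofactor !det_mx11 !mxE.
rewrite (_ : lift 0 0 = 1); last exact: val_inj.
rewrite (_ : lift 1 0 = 0); last exact: val_inj.
by rewrite /= !expr0 expr1 mul1r mulN1r mulrN.
Qed.

(** A matrix remembers, as its first column, the coprime pair that it completes, so
    that distinct pairs yield distinct matrices. *)
Lemma card_SL2Z_box_ge (n : nat) : (n ^ 2 <= 4 * card (SL2Z_box n))%N.
Proof.
apply: leq_trans (coprime_pairs_ge n) _; rewrite leq_mul2l /=.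
have ex (p : 'I_n * 'I_n) : exists M : 'M[int]_2, coprime p.1.+1 p.2.+1 ->
    [/\ SL2Z_box n M, M 0 0 = p.1.+1%:Z & M 1 0 = p.2.+1%:Z].
  have [cop|] := boolP (coprime p.1.+1 p.2.+1); last by exists 0.
  have [[y d] /= /andP[yi dj] e] := bezout_completion _ _ (ltn0Sn _) (ltn0Sn _) cop.
  exists (\matrix_(i, j) if j == 0 then (if i == 0 then p.1.+1 else p.2.+1)%:Z
                         else (if i == 0 then y else d)%:Z) => _.
  rewrite !mxE /=; split => //; split.
    rewrite /SL2Z /= det_mx22 !mxE /=; move: e; lia.
  move=> i j; rewrite !mxE.
  have [i1 j1] := (ltn_ord p.1, ltn_ord p.2).
  by case: eqP; case: eqP => _ _; lia.
have [f fP] := choice ex.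
apply: (fintype_leq_card _ _ f) => [|p|p q].
- exact: finite_SL2Z_box.
- by rewrite inE => /fP[].
rewrite !inE => /fP[_ p1 p2] /fP[_ q1 q2] fpq.
move: q1 q2; rewrite -fpq p1 p2 => -[e1] [e2].
by rewrite [p]surjective_pairing [q]surjective_pairing; congr (_, _); exact: val_inj.
Qed.

(** * An upper bound for the number of matrices of a congruence subgroup in a box *)

Lemma Gamma_entry_sub (b : nat) (M N : 'M[int]_2) i j :
  Gamma b M -> Gamma b N -> (b%:Z %| M i j - N i j)%Z.
Proof.
by move=> [_ /(_ i j) eM] [_ /(_ i j) eN]; rewrite -eqz_mod_dvd eM eN.
Qed.

Lemma Gamma1 (b : nat) : Gamma b 1%:M.
Proof. by split=> //; rewrite /SL2Z /= det1. Qed.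

Definition column_dominated (j : 'I_2) : set 'M[int]_2 :=
  [set M | exists i0, forall i k, `|M i k| <= `|M i0 j|].

Lemma column_dominatedP (M : 'M[int]_2) :
  column_dominated 0 M \/ column_dominated 1 M.
Proof.
have [p _ pP] := @arg_maxP _ _ _ (0, 0) xpredT
  (fun p : 'I_2 * 'I_2 => `|M p.1 p.2|) isT.
have dom : column_dominated p.2 M by exists p.1 => i k; exact: (pP (i, k)).
by case: (ord2_cases p.2) dom => ->; [left|right].
Qed.

(** This is [completion_unique] read in the dominant column; the second column is
    treated like the first because exchanging both the rows and the columns of a
    matrix preserves the determinant and Gamma(b). *)
Lemma Gamma_column_inj (b : nat) (j : 'I_2) (M N : 'M[int]_2) : (2 < b)%N ->
  Gamma b M -> Gamma b N -> column_dominated j M -> column_dominated j N ->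
  (forall i, M i j = N i j) -> M = N.
Proof.
move=> b2 GM GN [i0 M0] [i1 N0] col.
have N0' i k : `|N i k| <= `|M i0 j|.
  by apply: le_trans (N0 i k) _; rewrite -col.
have [dM dN] : \det M = 1 /\ \det N = 1 by case: GM GN => [? _] [? _].
have offdiag (L : 'M[int]_2) i k : Gamma b L -> i != k -> (b%:Z %| L i k)%Z.
  move=> GL ik; have := Gamma_entry_sub _ _ _ i k GL (Gamma1 b).
  by rewrite mxE (negbTE ik) subr0.
have [k [jk jkP]] : exists k : 'I_2, j != k /\ forall i, i = j \/ i = k.
  by case: (ord2_cases j) => ->; [exists 1|exists 0]; split=> // i;
    case: (ord2_cases i); tauto.
have det2 (L : 'M[int]_2) : \det L = L j j * L k k - L j k * L k j.
  rewrite det_mx22; move: jk; case: (ord2_cases j) => ->;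
  case: (ord2_cases k) => -> // _; ring.
have mE : `|M i0 j| = `|M j j| \/ `|M i0 j| = `|M k j|.
  by case: (jkP i0) => ->; [left|right].
have [] := completion_unique b (M j j) (M k j) (M j k) (M k k) (N j k) (N k k)
  `|M i0 j| b2 _ _ (offdiag _ _ _ GM jk) (offdiag _ _ _ GN jk) mE
  (M0 _ _) (M0 _ _) (N0' _ _) (N0' _ _).
- by rewrite -dM det2.
- by rewrite -dN det2 !col.
move=> e1 e2; apply/matrixP => x y.
by case: (jkP y) => ->; [exact: col|case: (jkP x) => ->].
Qed.

Lemma finite_Gamma_column_dominated (b n : nat) (j : 'I_2) :
  finite_set (Gamma b `&` SL2Z_box n `&` column_dominated j).
Proof.
by apply: finite_setI; left; apply: finite_setI; right; exact: finite_SL2Z_box.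
Qed.

Lemma card_Gamma_column_dominated (b n : nat) (j : 'I_2) : (2 < b)%N ->
  (card (Gamma b `&` SL2Z_box n `&` column_dominated j)
    <= ((2 * n) %/ b).+1 ^ 2)%N.
Proof.
move=> b2; rewrite -mulnn -[X in (_ <= X * _)%N]card_ord.
rewrite -[X in (_ <= _ * X)%N]card_ord -card_prod.
pose f (M : 'M[int]_2) := (residue_index n b (M 0 j), residue_index n b (M 1 j)).
apply: (card_leq_fintype _ f); first exact: finite_Gamma_column_dominated.
move=> M N [[GM [_ Mn]] domM] [[GN [_ Nn]] domN] [e0 e1].
apply: (Gamma_column_inj b j M N b2 GM GN domM domN) => i.
have b0 : (0 < b)%N by exact: leq_trans b2.
apply: (residue_index_inj n b) => //; first exact: Gamma_entry_sub.
by case: (ord2_cases i) => ->.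
Qed.

(** A nonzero multiple of b is too large to be an off-diagonal entry, and the
    diagonal entries are then 1 or -1; the sign is fixed by b > 2. *)
Lemma Gamma_box_large (b n : nat) (M : 'M[int]_2) : (2 < b)%N -> (n < b)%N ->
  Gamma b M -> SL2Z_box n M -> M = 1%:M.
Proof.
move=> b2 nb GM [dM Mn].
have small (x : int) : (b%:Z %| x)%Z -> `|x| < b%:Z -> x = 0.
  rewrite dvdzE => + xb; have [//|x0] := eqVneq x 0.
  by move/dvdn_leq; move: x0 xb; clear; lia.
have lt i j : `|M i j| < b%:Z by apply: le_lt_trans (Mn i j) _; rewrite ltz_nat.
have dv i j := Gamma_entry_sub _ _ _ i j GM (Gamma1 b).
have z01 : M 0 1 = 0 by apply: small => //; have := dv 0 1; rewrite mxE subr0.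
have z10 : M 1 0 = 0 by apply: small => //; have := dv 1 0; rewrite mxE subr0.
have m1 : M 0 0 * M 1 1 = 1.
  by move: dM; rewrite /SL2Z /= det_mx22 z01 mul0r subr0.
have m00 : M 0 0 = 1.
  apply: subr0_eq; apply: small; first by have := dv 0 0; rewrite mxE.
  have : absz (M 0 0) = 1%N.
    move: m1 => /(congr1 absz); rewrite abszM => /eqP.
    by rewrite muln_eq1 => /andP[/eqP].
  move: b2 (M 0 0) => + x; clear; lia.
have m11 : M 1 1 = 1 by move: m1; rewrite m00 mul1r.
apply/matrixP => i j.
by case: (ord2_cases i) => ->; case: (ord2_cases j) => ->; rewrite mxE.
Qed.

(** Removing the identity makes the bound hold for n < b too, so that, for fixed n,
    it can be summed over all the levels. *)
Lemma card_Gamma_box (b n : nat) : (2 < b)%N ->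
  (card ((Gamma b `&` SL2Z_box n) `\ 1%:M) * b ^ 2 <= 18 * n ^ 2)%N.
Proof.
move=> b2; have [nb|bn] := ltnP n b.
  rewrite (_ : _ `\ _ = set0) ?fset_set0 ?cardfs0 //.
  by apply/seteqP; split=> // M [[GM Mn]] /=; apply; exact: (Gamma_box_large b n M b2 nb).
set q := ((2 * n) %/ b)%N.
have finD := finite_Gamma_column_dominated b n.
have le2 : (card ((Gamma b `&` SL2Z_box n) `\ 1%:M) <= 2 * q.+1 ^ 2)%N.
  have sub : (Gamma b `&` SL2Z_box n) `\ 1%:M `<=`
      (Gamma b `&` SL2Z_box n `&` column_dominated 0) `|`
      (Gamma b `&` SL2Z_box n `&` column_dominated 1).
    by move=> M [GM _]; case: (column_dominatedP M) => ?; [left|right].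
  apply: leq_trans (card_sub_leq _ _ _ sub) _; first by rewrite finite_setU.
  apply: leq_trans (card_setU_leq _ _ _ _) _ => //.
  by rewrite mul2n -addnn leq_add // card_Gamma_column_dominated.
(* Here b <= n is used: the rounding term + b costs at most n. *)
have qb : (q.+1 * b <= 3 * n)%N.
  by rewrite mulSn; have := leq_divM (2 * n) b; rewrite -/q; lia.
apply: leq_trans (leq_mul le2 (leqnn _)) _.
rewrite -mulnA -expnMn -[18%N]/(2 * 3 ^ 2)%N -mulnA leq_mul2l /= -expnMn.
by rewrite leq_sqr.
Qed.

(** * The density *)

Lemma limn_einf_ge (R : realType) (u : nat -> \bar R) (c : \bar R) (N : nat) :
  (forall n, (N <= n)%N -> (c <= u n)%E) -> (c <= limn_einf u)%E.
Proof.
move=> cu; rewrite limn_einf_lim; apply: lime_ge; first exact: is_cvg_einfs.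
near=> n; apply: le_ereal_inf_tmp => _ [k /= nk <-]; apply: cu.
by apply: leq_trans nk; near: n; exists N.
Unshelve. all: by end_near. Qed.

(** The identity contributes 1, and the other matrices are counted level by level:
    18 n^2 / b_k^2 <= 72 #F_n / b_k^2 <= 8 pi^2 #F_n / b_k^2. *)
Lemma card_bigcup_Gamma_box (R : realType) (b : nat -> nat) (S : R) (n : nat) :
  (forall k, (2 < b k)%N) ->
  (forall K, \sum_(k < K) 8 * pi ^+ 2 / (b k)%:R ^+ 2 <= S) ->
  (card (SL2Z_box n `&` \bigcup_k Gamma (b k)))%:R
    <= 1 + S * (card (SL2Z_box n))%:R.
Proof.
move=> b2 bS; set U := SL2Z_box n `&` _; set F := card (SL2Z_box n).
have finU : finite_set U by apply: finite_setI; left; exact: finite_SL2Z_box.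
have finX : finite_set (U `\ 1%:M) by exact: finite_setD.
have U1 : (card U <= 1 + card (U `\ 1%:M))%N.
  have card1 : card [set (1%:M : 'M[int]_2)] = 1%N by rewrite fset_set1 cardfs1.
  rewrite -[X in (_ <= X + _)%N]card1.
  apply: leq_trans (card_setU_leq _ _ _ finX) => //.
  apply: card_sub_leq; first by rewrite finite_setU.
  by move=> M UM; have [->|/eqP M1] := eqVneq M 1%:M; [left|right].
have [|K XK] := card_bigcup_leq (fun k => Gamma (b k)) (U `\ 1%:M) finX.
  by move=> M [[]].
apply: (@le_trans _ _ (1 + (card (U `\ 1%:M))%:R)).
  by rewrite nat1r ler_nat.
rewrite lerD2l; apply: le_trans (ler_wpM2r (ler0n _ _) (bS K)).
rewrite mulr_suml; apply: (@le_trans _ _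
  (\sum_(k < K) card ((U `\ 1%:M) `&` Gamma (b k)))%N%:R); first by rewrite ler_nat.
rewrite natr_sum; apply: ler_sum => k _.
have bk0 : 0 < (b k)%:R :> R by rewrite ltr0n; exact: leq_trans (b2 k).
rewrite mulrAC ler_pdivlMr ?exprn_gt0 //.
apply: (@le_trans _ _ (72 * F%:R)); last first.
  by rewrite ler_wpM2r //; have := pi_sqr_ge9 R; lra.
rewrite -natrX -!natrM ler_nat.
apply: (@leq_trans (18 * n ^ 2)); last first.
  by have := card_SL2Z_box_ge n; rewrite -/F; lia.
apply: leq_trans (card_Gamma_box (b k) n (b2 k)); rewrite leq_mul2r.
apply/orP; right; apply: card_sub_leq.
  by apply: finite_setD; apply: finite_setI; right; exact: finite_SL2Z_box.
by move=> M [[[Mn _] M1] GM].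
Qed.

Theorem theorem31 (R : realType) (b : nat -> nat)
    (b_gt0 : forall n, (0 < b n)%N)
    (b_coprime : forall m n : nat, m != n -> coprime (b m) (b n))
    (b_sum : (\sum_(0 <= n <oo) (8 * pi ^+ 2 / (b n)%:R ^+ 2 : R)%:E < 1%:E)%E) :
  (0%:E < lower_density R (SL2Z `\` \bigcup_n Gamma (b n)))%E.
Proof.
pose t n : R := 8 * pi ^+ 2 / (b n)%:R ^+ 2.
have t0 n : 0 <= t n.
  by rewrite /t mulr_ge0 ?invr_ge0 ?exprn_ge0 // mulr_ge0 ?exprn_ge0 ?pi_ge0.
have [S S1 tS] : exists2 S : R, S < 1 & forall K, \sum_(k < K) t k <= S.
  set s := (\sum_(0 <= n <oo) (t n)%:E)%E.
  have s0 : (0 <= s)%E by apply: nneseries_ge0 => n _ _; rewrite lee_fin.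
  have sfin : s \is a fin_num by rewrite ge0_fin_numE // (lt_trans b_sum) // ltry.
  exists (fine s); first by rewrite -lte_fin fineK.
  move=> K; rewrite -lee_fin fineK // -sumEFin -(big_mkord xpredT (EFin \o t)).
  by apply: nneseries_lim_ge => k _ _; rewrite lee_fin.
have S0 : 0 <= S by have := tS 0%N; rewrite big_ord0.
have b2 k : (2 < b k)%N.
  have bk0 : 0 < (b k)%:R ^+ 2 :> R by rewrite exprn_gt0 // ltr0n.
  have : t k < 1.
    apply: le_lt_trans S1; apply: le_trans (tS k.+1).
    by rewrite big_ord_recr /= lerDr sumr_ge0.
  rewrite /t ltr_pdivrMr // mul1r => lt.
  rewrite ltnNge; apply/negP; rewrite -(ler_nat R) => bk2.
  have b4 : (b k)%:R ^+ 2 <= 4 :> R.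
    by rewrite (_ : 4 = 2 ^+ 2) ?ler_pXn2r ?nnegrE //; ring.
  by have := pi_sqr_ge9 R; lra.
(* Half of 1 - S absorbs the term 1 / #F_n as soon as #F_n >= 1 / c. *)
pose c := (1 - S) / 2.
have c0 : 0 < c by rewrite /c; lra.
apply: (@lt_le_trans _ _ c%:E); first by rewrite lte_fin.
have [N NP] : exists N, forall n, (N <= n)%N -> c^-1 <= (card (SL2Z_box n))%:R :> R.
  (* The factor 4 is the one in n ^ 2 <= 4 #F_n. *)
  exists (Num.bound (4 / c)) => n Nn.
  have := archi_boundP (divr_ge0 (ler0n R 4) (ltW c0)) => lt.
  have : 4 / c <= (n ^ 2)%:R :> R.
    apply: le_trans (ltW lt) _; rewrite ler_nat (leq_trans Nn) //.
    by rewrite -mulnn; nia.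
  have : (n ^ 2)%:R <= 4 * (card (SL2Z_box n))%:R :> R.
    by rewrite -natrM ler_nat card_SL2Z_box_ge.
  by lra.
apply: (limn_einf_ge _ _ _ N) => n /NP; rewrite lee_fin.
set A := SL2Z `\` _; set U := \bigcup_n Gamma (b n).
have fin X : finite_set (SL2Z_box n `&` X).
  by apply: finite_setI; left; exact: finite_SL2Z_box.
have split :
    (card (SL2Z_box n) <= card (A `&` SL2Z_box n) + card (SL2Z_box n `&` U))%N.
  rewrite [A `&` _]setIC; apply: leq_trans (card_setU_leq _ _ _ _) => //.
  apply: card_sub_leq; first by rewrite finite_setU.
  move=> M Mn; have [UM|nUM] := pselect (U M); first by right.
  by left; split=> //; case: Mn.
have := card_bigcup_Gamma_box R b S n b2 tS; rewrite -/U.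
move: split; rewrite -(ler_nat R) natrD.
set F : R := (card (SL2Z_box n))%:R; set a : R := (card (A `&` _))%:R.
set u : R := (card (_ `&` U))%:R => Fau uS cF.
have F0 : 0 < F by apply: lt_le_trans cF; rewrite invr_gt0.
rewrite ler_pdivlMr //.
have : 1 <= c * F by rewrite mulrC -ler_pdivrMr // mul1r.
rewrite /c; nra.
Qed.
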